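(* Let $I_R(x)=\int_0^\infty e^{-xt}\,\dfrac{dt}{t(\pi^2+\log^2 t)}$ for $x>0$, and let $I_R^{(n)}$ denote its $n$-th derivative on $(0,\infty)$. For any integer $n\ge 2$ and real $\alpha$, define $$H_n(x;\alpha)=\left(I_R^{(n)}(x)\right)^2-\alpha\, I_R^{(n-1)}(x)\,I_R^{(n+1)}(x),\qquad x>0.$$ Then the following statements hold for every integer $n\ge2$. (i) If $x\mapsto H_n(x;\alpha)$ is completely monotonic on $(0,\infty)$, then $\alpha\le\dfrac{n-1}{n}$. (ii) If $\alpha\le\dfrac{n-2}{n-1}$, then $x\mapsto H_n(x;\alpha)$ is completely monotonic on $(0,\infty)$.
   Context: $\log^2 t$ means $(\log t)^2$. A function $f$ is completely monotonic on $(0,\infty)$ if it is infinitely differentiable and $(-1)^k f^{(k)}(x)\ge 0$ for all $x>0$ and every non-negative integer $k$. *)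

(* Defs.v *)
From HB Require Import structures.
From mathcomp Require Import all_boot all_order all_algebra.
From mathcomp Require Import all_classical all_reals all_analysis.
Set Implicit Arguments.
Unset Strict Implicit.
Unset Printing Implicit Defensive.
Import Order.TTheory GRing.Theory Num.Theory.
Import numFieldNormedType.Exports.
Local Open Scope classical_set_scope.
Local Open Scope ring_scope.

(* Functions on (0, +oo) are represented by total functions on R.  Only points
   x > 0 are ever inspected, and since (0, +oo) is open the derivatives there
   do not depend on the values taken elsewhere.  The derivability conjunct is
   needed because f^`(k) is total, with arbitrary values where the limit of
   difference quotients does not exist. *)
Definition completely_monotonic (R : realType) (f : R -> R) : Prop :=
  forall (k : nat) (x : R), 0 < x ->
    derivable f^`(k)%classic x 1 /\ 0 <= (-1) ^+ k * f^`(k)%classic x.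

(* The integrand is positive and, for x >= 0, integrable; for x < 0 the integral
   diverges and I_R x is the default value 0. *)
Definition I_R (R : realType) (x : R) : R :=
  \int[lebesgue_measure]_(t in `]0, +oo[)
    (expR (- (x * t)) / (t * (pi ^+ 2 + ln t ^+ 2))).

(* Meant for n >= 1, because of the truncated predecessor. *)
Definition H (R : realType) (n : nat) (alpha x : R) : R :=
  ((@I_R R)^`(n)%classic x) ^+ 2
    - alpha * (@I_R R)^`(n.-1)%classic x * (@I_R R)^`(n.+1)%classic x.

(* Main.v *)
Require Import Defs.
From mathcomp Require Import all_boot all_order all_algebra.
From mathcomp Require Import all_classical all_reals all_analysis.
From mathcomp Require Import measurable_realfun ring lra.
Set Implicit Arguments.
Unset Strict Implicit.
Unset Printing Implicit Defensive.
Import Order.TTheory GRing.Theory Num.Theory.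
Import numFieldNormedType.Exports.
Local Open Scope classical_set_scope.
Local Open Scope ring_scope.

(** Write w(t) = 1 / (t (pi^2 + ln^2 t)) and F_m(x) for the integral over
    (0, +oo) of t^m e^(-x t) w(t) dt.  The weight w is integrable, with
    primitive atan (ln t / pi) / pi, so F_0 = I_R may be differentiated under
    the integral sign: F_m' = - F_(m+1), the n-th derivative of I_R is
    (-1)^n F_n, and H_n = F_n^2 - alpha F_(n-1) F_(n+1).  Integrating the
    derivative of t^m e^(-x t) / (pi^2 + ln^2 t) gives, for m >= 1,
      x F_(m+1) = m F_m - 2 E_m   ([moment_recurrence]),
    where E_m is F_m with the extra factor lam(t) = ln t / (pi^2 + ln^2 t) in
    the integrand.

    (i) Since lam tends to 0 at 0+ and is bounded, lam is at most eps + C t in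
    absolute value, and the recurrence then gives |E_m| <= eps F_m for x large
    ([lmoment_small]).  Hence x F_n <= (n - 1 + 2 eps) F_(n-1) and
    x F_(n+1) >= (n - 2 eps) F_n.  Together with H_n >= 0, that is, complete
    monotonicity at order 0 alone, this forces alpha <= (n - 1) / n.

    (ii) By Leibniz, (-1)^k H_n^(k) is a combination of the double integrals
    of (u+v)^k u^a v^b e^(-x(u+v)) w(u) w(v), which are finite sums of products
    of moments ([leibniz]).  Put q(t) = t / (pi^2 + ln^2 t) = t^2 w(t) and
    m = n - 2.  For m >= 1 and alpha = m / (m + 1), the identity
      (d/du - d/dv) ((u v)^m (v - u))
        = m (u v)^(m-1) (u^2 + v^2) - 2 (m + 1) (u v)^m
    and an integration by parts along the lines u + v = s ([leibniz_by_parts])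
    show that 2 (m + 1) (-1)^k H_n^(k) is the integral of
      (u+v)^k e^(-x(u+v)) (u v)^m (v - u) (q'(u) q(v) - q(u) q'(v)),
    which is nonnegative because q is log-concave ([psi_div_nincr]).  Smaller
    values of alpha only add a multiple of F_(n-1) F_(n+1), and for n = 2 the
    critical value is alpha = 0.  No double integral is evaluated by Fubini:
    all kernels that occur are finite sums of products f(u) g(v), for which
    iterated integrals suffice ([iterated]). *)

(** * Integration over the positive half-line *)

Section ImproperIntegrals.
Context {R : realType}.
Local Notation mu := (@lebesgue_measure R).
Local Notation pos := (`]0, +oo[%classic : set R).

Lemma in_posE (t : R) : pos t = (0 < t) :> Prop.
Proof. by rewrite /= in_itv/= andbT. Qed.

Lemma measurable_pos : measurable (pos : set (measurableTypeR R)).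
Proof. exact: measurable_itv. Qed.

(** Lebesgue integrability over the open half-line ]0, +oo[. *)
Definition integrable0y (f : R -> R) : Prop := mu.-integrable pos (EFin \o f).

(** The real-valued Lebesgue integral over ]0, +oo[, as used in [I_R]. *)
Definition integral0y (f : R -> R) : R := \int[mu]_(t in pos) f t.

Lemma eq_integrable0y (f g : R -> R) :
  (forall t : R, 0 < t -> f t = g t) -> integrable0y f -> integrable0y g.
Proof.
move=> fg; apply: (eq_integrable measurable_pos) => t.
by rewrite inE in_posE => t0 /=; rewrite fg.
Qed.

Lemma integrable0yD (f g : R -> R) :
  integrable0y f -> integrable0y g -> integrable0y (fun t => f t + g t).
Proof. exact: (integrableD measurable_pos). Qed.

Lemma integrable0yZ (c : R) (f : R -> R) :
  integrable0y f -> integrable0y (fun t => c * f t).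
Proof. exact: (integrableZl measurable_pos). Qed.

Lemma eq_integral0y (f g : R -> R) :
  (forall t : R, 0 < t -> f t = g t) -> integral0y f = integral0y g.
Proof.
by move=> fg; apply: eq_Rintegral => t; rewrite inE in_posE => /fg.
Qed.

Lemma integral0yD (f g : R -> R) : integrable0y f -> integrable0y g ->
  integral0y (fun t => f t + g t) = integral0y f + integral0y g.
Proof. exact: (RintegralD measurable_pos). Qed.

Lemma integral0yZ (c : R) (f : R -> R) :
  integrable0y f -> integral0y (fun t => c * f t) = c * integral0y f.
Proof. by move=> intf; apply: (RintegralZl c measurable_pos intf). Qed.

Lemma integral0y_ge0 (f : R -> R) :
  (forall t : R, 0 < t -> 0 <= f t) -> 0 <= integral0y f.
Proof.
by move=> f0; apply: Rintegral_ge0 => t; rewrite in_posE => /f0.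
Qed.

Lemma le_integral0y (f g : R -> R) : integrable0y f -> integrable0y g ->
  (forall t : R, 0 < t -> f t <= g t) -> integral0y f <= integral0y g.
Proof.
move=> intf intg fg; apply: (le_Rintegral measurable_pos intf intg) => t.
by rewrite in_posE => /fg.
Qed.

Lemma integral0y_gt0 (f : R -> R) : integrable0y f ->
  (forall t : R, 0 < t -> 0 < f t) -> 0 < integral0y f.
Proof.
move=> intf f0; rewrite lt0r integral0y_ge0 ?andbT; last by move=> t /f0/ltW.
apply/eqP => If0.
(* A zero integral makes f vanish almost everywhere, so that ]0, +oo[ would be
   a null set. *)
have normf : (\int[mu]_(t in pos) `|(EFin \o f) t| = 0)%E.
  rewrite (_ : (\int[mu]_(t in pos) _)%E = (\int[mu]_(t in pos) (f t)%:E)%E).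
    rewrite -[LHS]fineK; first by congr EFin; exact: If0.
    exact: (integrable_fin_num measurable_pos).
  apply: eq_integral => t; rewrite inE in_posE => /f0 t0.
  by rewrite /= gtr0_norm.
have mf := measurable_int _ intf.
have [A [mA A0 posA]] := (ae_eq_integral_abs _ measurable_pos mf).1 normf.
have : (mu pos <= mu A)%E.
  apply: le_measure; rewrite ?inE//.
  move=> t t0; apply: posA => /= /(_ t0) [ft0].
  by move: t0; rewrite in_posE => /f0; rewrite ft0 ltxx.
by rewrite A0 lebesgue_measure_itv/= ltry.
Qed.

Lemma measurable_fun_pos (f : R -> R) :
  (forall t : R, 0 < t -> {for t, continuous f}) -> measurable_fun pos f.
Proof.
move=> cf; apply: open_continuous_measurable_fun.
  exact: interval_open.
by move=> t; rewrite inE in_posE => /cf.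
Qed.

Lemma FTC0y (F f : R -> R) (a b : R) : 0 < a -> a < b ->
  (forall t : R, 0 < t -> is_derive t 1 F (f t)) ->
  (forall t : R, 0 < t -> {for t, continuous f}) ->
  (\int[mu]_(t in `[a, b]) (f t)%:E = (F b - F a)%:E)%E.
Proof.
move=> a0 ab dF cf; rewrite EFinB.
have cF (t : R) : 0 < t -> {for t, continuous F}.
  move=> /dF[dFt _]; apply: differentiable_continuous.
  exact/derivable1_diffP.
apply: continuous_FTC2 => //.
- apply: continuous_in_subspaceT => t; rewrite inE/= in_itv/= => /andP[at_ _].
  by apply: cf; exact: lt_le_trans at_.
- split.
  + move=> t; rewrite in_itv/= => /andP[at_ _].
    by have [] := dF _ (lt_trans a0 at_).
  + by apply: cvg_at_right_filter; apply: cF.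
  + by apply: cvg_at_left_filter; apply: cF; exact: lt_trans ab.
- move=> t; rewrite in_itv/= => /andP[at_ _].
  by rewrite derive1E; have [_ ->] := dF _ (lt_trans a0 at_).
Qed.

(** Compact intervals [1/(i+2), i+2] that exhaust ]0, +oo[; the shift by 2 makes
    each of them nondegenerate. *)
Definition exhaust (i : nat) : set R := `[i.+2%:R^-1, i.+2%:R]%classic.

Lemma nondecreasing_exhaust : nondecreasing_seq exhaust.
Proof.
move=> i j ij; rewrite subsetEset /exhaust; apply: subset_itvScc.
  by rewrite bnd_simp lef_pV2 ?posrE ?ltr0n// ler_nat !ltnS.
by rewrite bnd_simp ler_nat !ltnS.
Qed.

Lemma exhaust_lt i : i.+2%:R^-1 < i.+2%:R :> R.
Proof.
by rewrite (@lt_trans _ _ 1)// ?ltr1n// invf_lt1 ?ltr0n// ltr1n.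
Qed.

Lemma exhaust_pos i : exhaust i `<=` pos.
Proof.
move=> t; rewrite in_posE /exhaust/= in_itv/= => /andP[+ _].
by apply: lt_le_trans; rewrite invr_gt0 ltr0n.
Qed.

Lemma exhaust_near (t : R) : 0 < t -> \forall i \near \oo, exhaust i t.
Proof.
move=> t0; near=> i; rewrite /exhaust/= in_itv/=; apply/andP; split.
  rewrite invf_ple ?posrE ?ltr0n//.
  near: i; case: (@nbhs_infty_ger R (t^-1)) => N _ HN; exists N => // i /HN/=.
  by move=> /le_trans; apply; rewrite ler_nat -addn2 leq_addr.
near: i; case: (@nbhs_infty_ger R t) => N _ HN; exists N => // i /HN/=.
by move=> /le_trans; apply; rewrite ler_nat -addn2 leq_addr.
Unshelve. all: end_near. Qed.

Lemma bigcup_exhaust : \bigcup_i exhaust i = pos.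
Proof.
apply/seteqP; split => [t [i _]|t]; first exact: exhaust_pos.
rewrite in_posE => /exhaust_near[N _ HN]; exists N => //.
by apply: HN => /=.
Qed.

(** A nonnegative function whose primitive has bounded increments is
    integrable, by monotone convergence along [exhaust]. *)
Lemma ge0_integrable0y (F f : R -> R) (M : R) :
  (forall t : R, 0 < t -> is_derive t 1 F (f t)) ->
  (forall t : R, 0 < t -> {for t, continuous f}) ->
  (forall t : R, 0 < t -> 0 <= f t) ->
  (forall a b : R, 0 < a -> 0 < b -> F b - F a <= M) ->
  integrable0y f.
Proof.
move=> dF cf f0 FM; apply/integrableP; split.
  by apply/measurable_EFinP; exact: measurable_fun_pos.
rewrite [ltLHS](_ : _ = \int[mu]_(t in pos) (f t)%:E)%E; last first.
  apply: eq_integral => t; rewrite inE in_posE => t0.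
  by rewrite /= ger0_norm// f0.
have := @ge0_nondecreasing_set_cvg_integral _ (measurableTypeR R) R exhaust
  (EFin \o f) lebesgue_measure
  nondecreasing_exhaust.
rewrite bigcup_exhaust => /(_ _ _ _)/cvg_lim <- //; last 3 first.
- by move=> i; exact: measurable_itv.
- move=> i; apply: (measurable_funS measurable_pos); first exact: exhaust_pos.
  by apply/measurable_EFinP; exact: measurable_fun_pos.
- by move=> i t /exhaust_pos; rewrite in_posE => t0; rewrite lee_fin f0.
apply: (@le_lt_trans _ _ M%:E); last by rewrite ltry.
apply: lime_le.
  apply: ereal_nondecreasing_is_cvgn.
  apply: ge0_nondecreasing_set_nondecreasing_integral => //.
  - exact: nondecreasing_exhaust.
  - by move=> i; exact: measurable_itv.
  - move=> i; apply: (measurable_funS measurable_pos); first exact: exhaust_pos.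
    by apply/measurable_EFinP; exact: measurable_fun_pos.
  - by move=> i t /exhaust_pos; rewrite in_posE => t0; rewrite lee_fin f0.
apply: nearW => i; rewrite (@FTC0y F)//; last exact: exhaust_lt.
by rewrite lee_fin FM.
Qed.

(** Fundamental theorem of calculus over ]0, +oo[ for an integrable
    derivative; the limits of the primitive are only needed along [exhaust]. *)
Lemma integral0y_derive (F f : R -> R) (l0 l1 : R) :
  (forall t : R, 0 < t -> is_derive t 1 F (f t)) ->
  (forall t : R, 0 < t -> {for t, continuous f}) ->
  integrable0y f ->
  F i.+2%:R^-1 @[i --> \oo] --> l0 -> F i.+2%:R @[i --> \oo] --> l1 ->
  integral0y f = l1 - l0.
Proof.
move=> dF cf intf F0 F1; rewrite /integral0y /Rintegral.
pose g i := (f \_ (exhaust i) : R -> R).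
have intg i : (\int[mu]_(t in pos) (g i t)%:E =
    (F i.+2%:R - F i.+2%:R^-1)%:E)%E.
  rewrite -(@FTC0y F f) ?exhaust_lt//.
  rewrite [RHS]integral_mkcond [LHS]integral_mkcond -/(exhaust i).
  apply: eq_integral => t _; rewrite /g !patchE.
  have [ti|] := boolP (t \in exhaust i); last by case: ifP.
  by rewrite mem_set//; apply: (@exhaust_pos i); exact: set_mem.
have : (\int[mu]_(t in pos) (g i t)%:E @[i --> \oo] -->
        \int[mu]_(t in pos) (f t)%:E)%E.
  apply: (@dominated_cvg _ (measurableTypeR R) R lebesgue_measure _
    measurable_pos (fun i t => (g i t)%:E) _
    (fun t => `|f t|%:E)) => //.
  - move=> i; apply/measurable_EFinP.
    apply/(measurable_restrict _ (measurable_itv _) measurable_pos).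
    apply: (measurable_funS measurable_pos) => //.
    exact: measurable_fun_pos.
  - move=> t; rewrite in_posE => t0; apply: cvg_near_cst.
    near=> i; rewrite /g patchE mem_set//.
    by near: i; exact: exhaust_near.
  - exact: integrable_norm.
  - move=> i t t0; rewrite lee_fin /g patchE; case: ifP => //.
    by rewrite normr0.
under eq_fun do rewrite intg.
move=> /cvg_lim <- //.
have /cvg_lim -> // :
  (F i.+2%:R - F i.+2%:R^-1)%:E @[i --> \oo] --> (l1 - l0)%:E.
by apply: cvg_EFin; [exact: nearW | exact: cvgB].
Unshelve. all: end_near. Qed.

End ImproperIntegrals.

(** * Moments of the weight and their recurrence *)

Section Moments.
Context {R : realType}.
Local Notation pos := (`]0, +oo[%classic : set R).
Implicit Types (t x : R) (m : nat).

(** The function pi^2 + ln^2 t. *)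
Definition ell t : R := pi ^+ 2 + ln t ^+ 2.

(** The weight 1 / (t (pi^2 + ln^2 t)) of the integral [I_R]. *)
Definition wgt t : R := (t * ell t)^-1.

(** The logarithmic factor ln t / (pi^2 + ln^2 t), so that the logarithmic
    derivative of 1 / (pi^2 + ln^2 t) is - 2 lam t / t. *)
Definition lam t : R := ln t / ell t.

(** The integrand of the m-th moment; for m = 0 it is the integrand of [I_R]. *)
Definition lker m x t : R := t ^+ m * expR (- (x * t)) * wgt t.

Lemma ell_ge4 t : 4 <= ell t.
Proof.
have := pi_ge2 R; have := sqr_ge0 (ln t); rewrite /ell; nra.
Qed.

Lemma ell_gt0 t : 0 < ell t.
Proof. by have := ell_ge4 t; lra. Qed.

Lemma ell_neq0 t : ell t != 0.
Proof. by rewrite gt_eqF// ell_gt0. Qed.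

Lemma wgt_gt0 t : 0 < t -> 0 < wgt t.
Proof. by move=> t0; rewrite invr_gt0 mulr_gt0// ell_gt0. Qed.

Lemma normr_lam_le1 t : `|lam t| <= 1.
Proof.
rewrite /lam normf_div (gtr0_norm (ell_gt0 t)) ler_pdivrMr ?ell_gt0// mul1r.
have := pi_ge2 R; have := sqr_ge0 (`|ln t| - 1).
by rewrite /ell -(real_normK (num_real (ln t))); nra.
Qed.

Lemma is_derive_ell t : 0 < t -> is_derive t 1 ell (2 * ln t / t).
Proof.
move=> t0; have dl := is_derive1_ln t0.
rewrite (_ : ell = cst (pi ^+ 2) + (@ln R) ^+ 2); last exact/funext.
have dD := is_deriveD (is_derive_cst (pi ^+ 2 : R) t 1) (is_deriveX 2 dl).
by apply: (is_derive_eq dD); rewrite add0r /GRing.scale/= expr1; ring.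
Qed.

Lemma is_derive_wgt t : 0 < t ->
  is_derive t 1 wgt (- (1 + 2 * lam t) / t * wgt t).
Proof.
move=> t0; have dl := is_derive_ell t0.
have dV : is_derive t 1 (fun u : R => (u * ell u)^-1)
    (- (t * ell t) ^- 2 *: (t *: (2 * ln t / t) + ell t *: 1)).
  apply: is_deriveV; first by rewrite mulf_neq0 ?ell_neq0// gt_eqF.
apply: (is_derive_eq dV).
rewrite /wgt /lam /GRing.scale/=; field.
by rewrite ell_neq0 gt_eqF.
Qed.

Lemma is_derive_lam t : 0 < t -> is_derive t 1 lam
  ((1 - 2 * ln t * lam t) / (t * ell t)).
Proof.
move=> t0; have dl := is_derive_ell t0; have dln := is_derive1_ln t0.
have dV : is_derive t 1 (fun u : R => (ell u)^-1)
    (- (ell t) ^- 2 *: (2 * ln t / t)).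
  by apply: is_deriveV; rewrite ell_neq0.
have := is_deriveM dln dV => dM.
apply: (is_derive_eq dM).
rewrite /lam /GRing.scale/=; field.
by rewrite ell_neq0 gt_eqF.
Qed.

Lemma is_derive_expRN (a b : R) :
  is_derive a 1 (fun u : R => expR (- (b * u))) (- b * expR (- (b * a))).
Proof.
have d1 : is_derive a 1 (fun u : R => - (b * u)) (- b).
  have := is_deriveN (is_deriveZ b (@is_derive_id R R a 1)).
  by rewrite /GRing.scale/= mulr1.
have := @is_derive1_comp R _ (fun u => - (b * u)) a _ _
  (is_derive_expR (- (b * a))) d1.
by rewrite mulrC.
Qed.

Lemma is_derive_lker m x t : 0 < t ->
  is_derive t 1 (lker m x) (((m%:R - 1 - 2 * lam t) / t - x) * lker m x t).
Proof.
move=> t0; have dw := is_derive_wgt t0; have de := is_derive_expRN t x.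
have dX : is_derive t 1 (fun u : R => u ^+ m) (m%:R / t * t ^+ m).
  have := is_deriveX m (@is_derive_id R R t 1).
  rewrite /GRing.scale/= mulr1.
  rewrite (_ : (id : R -> R) ^+ m = (fun u => u ^+ m)); last first.
    by apply/funext => u; rewrite exprfctE.
  have -> : m%:R / t * t ^+ m = m%:R * t ^+ m.-1; last by [].
  by case: m => [|m]; rewrite ?mul0r// exprS/=; field; rewrite gt_eqF.
have := is_deriveM (is_deriveM dX de) dw => dM.
apply: (is_derive_eq dM).
rewrite /lker mulrfctE /GRing.scale/=; field.
by rewrite gt_eqF.
Qed.

Lemma is_derive_continuous (f : R -> R) x (d : R) :
  is_derive x 1 f d -> {for x, continuous f}.
Proof.
by move=> [dfx _]; apply: differentiable_continuous; apply/derivable1_diffP.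
Qed.

Lemma continuous_lker m x t : 0 < t -> {for t, continuous (lker m x)}.
Proof. by move=> /(is_derive_lker m x)/is_derive_continuous. Qed.

Lemma lkerS m x t : lker m.+1 x t = t * lker m x t.
Proof. by rewrite /lker exprS; ring. Qed.

Lemma lker_gt0 m x t : 0 < t -> 0 < lker m x t.
Proof.
by move=> t0; rewrite /lker !mulr_gt0 ?exprn_gt0 ?expR_gt0 ?wgt_gt0.
Qed.

Lemma exprn_expRN_le m x t : 0 < x -> 0 < t ->
  t ^+ m * expR (- (x * t)) <= m`!%:R / x ^+ m.
Proof.
move=> x0 t0; rewrite expRN ler_pdivrMr ?expR_gt0//.
rewrite -mulrA -ler_pdivrMl ?ltr0n ?fact_gt0// ler_pdivlMl ?exprn_gt0//.
rewrite mulrCA -exprMn.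
case: m => [|m].
  by rewrite fact0 invr1 mul1r expr0 ltW// expR_gt1 mulr_gt0.
have := @expR_ge1Dxn R (x * t) m (ltW (mulr_gt0 x0 t0)).
by rewrite mulrC; lra.
Qed.

Lemma lker_le m x t : 0 < x -> 0 < t -> lker m x t <= m`!%:R / x ^+ m * wgt t.
Proof.
by move=> x0 t0; rewrite /lker ler_wpM2r ?exprn_expRN_le// ltW// wgt_gt0.
Qed.

(** The primitive atan (ln t / pi) / pi has total variation at most 1. *)
Lemma integrable_wgt : integrable0y wgt.
Proof.
have pi0 := pi_gt0 R.
apply: (@ge0_integrable0y _ (fun t => atan (ln t / pi) / pi) _ 1).
- move=> t t0; have dl := is_derive1_ln t0.
  have d1 : is_derive t 1 (fun u : R => ln u / pi) (t^-1 / pi).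
    have := is_deriveZ (pi^-1 : R) dl.
    rewrite /GRing.scale/= [in X in X -> _]mulrC.
    by congr is_derive; apply/funext => u; rewrite /= /GRing.scale/= mulrC.
  have d2 := is_derive1_atan (ln t / pi).
  have d3 := @is_derive1_comp R _ (fun u => ln u / pi) t _ _ d2 d1.
  have d4 := is_deriveZ (pi^-1 : R) d3.
  rewrite (_ : (fun u : R => atan (ln u / pi) / pi) =
     (pi^-1 \*: (@atan R \o (fun u : R => ln u / pi)))); last first.
    by apply/funext => u; rewrite /= /GRing.scale/= mulrC.
  apply: (is_derive_eq d4); rewrite /GRing.scale/= /wgt /ell.
  have := ell_neq0 t; rewrite /ell.
  move: (@pi R) pi0 {d1 d2 d3 d4} => p p0 e0; field.
  by rewrite e0 !gt_eqF.
- by move=> t t0; have /is_derive_continuous := is_derive_wgt t0.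
- by move=> t /wgt_gt0/ltW.
- move=> a b a0 b0; rewrite -mulrBl ler_pdivrMr// mul1r.
  have := atan_ltpi2 (ln b / pi); have := atan_gtNpi2 (ln a / pi); lra.
Qed.

Lemma integrable_bounded_lker (phi : R -> R) (C : R) m x : 0 < x ->
  (forall t : R, 0 < t -> {for t, continuous phi}) ->
  (forall t : R, 0 < t -> `|phi t| <= C) ->
  integrable0y (fun t => phi t * lker m x t).
Proof.
move=> x0 cphi phiC; pose D := C * (m`!%:R / x ^+ m).
apply: (@le_integrable _ (measurableTypeR R) R lebesgue_measure _
  measurable_pos _ (fun t => (D * wgt t)%:E)).
- apply/measurable_EFinP; apply: measurable_fun_pos => t t0.
  by apply: continuousM; [exact: cphi|exact: continuous_lker].
- move=> t; rewrite in_posE => t0; rewrite lee_fin.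
  rewrite normrM (gtr0_norm (lker_gt0 _ _ t0)).
  apply: le_trans (ler_norm _).
  rewrite /D -mulrA; apply: ler_pM => //.
  + exact/ltW/lker_gt0.
  + exact: phiC.
  + exact: lker_le.
- exact: (integrableZl measurable_pos D integrable_wgt).
Qed.

(** The m-th moment, equal to (-1)^m times the m-th derivative of [I_R]. *)
Definition moment m x : R := integral0y (lker m x).

(** The m-th moment with the additional factor [lam]. *)
Definition lmoment m x : R := integral0y (fun t => lam t * lker m x t).

Lemma integrable_lker m x : 0 < x -> integrable0y (lker m x).
Proof.
move=> x0; have := @integrable_bounded_lker (cst 1) 1 m x x0.
rewrite (_ : (fun t => _) = lker m x); last first.
  by apply/funext => t; rewrite /= mul1r.
apply; first by move=> t _; exact: cvg_cst.
by move=> t _; rewrite normr1.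
Qed.

Lemma continuous_lam t : 0 < t -> {for t, continuous lam}.
Proof. by move=> /is_derive_lam/is_derive_continuous. Qed.

Lemma integrable_lam_lker m x : 0 < x ->
  integrable0y (fun t => lam t * lker m x t).
Proof.
move=> x0; apply: (@integrable_bounded_lker lam 1) => // t t0.
  exact: continuous_lam.
exact: normr_lam_le1.
Qed.

Lemma moment_gt0 m x : 0 < x -> 0 < moment m x.
Proof.
move=> x0; apply: integral0y_gt0; first exact: integrable_lker.
by move=> t; exact: lker_gt0.
Qed.

Lemma is_derive_lker_param m x t :
  is_derive x 1 ((lker m)^~ t) (- lker m.+1 x t).
Proof.
have := is_derive_expRN x t => d1.
have d2 := is_deriveZ (t ^+ m * wgt t) d1.
rewrite (_ : (lker m)^~ t =
  (t ^+ m * wgt t) \*: (fun u : R => expR (- (t * u)))); last first.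
  by apply/funext => y; rewrite /lker /= /GRing.scale/= (mulrC y); ring.
apply: (is_derive_eq d2).
by rewrite lkerS /lker /GRing.scale/= (mulrC x); ring.
Qed.

(** Differentiation under the integral sign, on a neighbourhood of x bounded
    away from 0, where [lker_le] gives an integrable majorant. *)
Lemma is_derive_moment m x : 0 < x ->
  is_derive x 1 (moment m) (- moment m.+1 x).
Proof.
move=> x0; have x20 : 0 < x / 2 by lra.
pose G t : R := `|m.+1`!%:R / (x / 2) ^+ m.+1 * wgt t|.
have intG : integrable0y G.
  pose c : R := m.+1`!%:R / (x / 2) ^+ m.+1.
  exact: (integrable_norm (integrable0yZ c integrable_wgt)).
have xI : `]x / 2, x + 1[%classic x by rewrite /= in_itv/=; lra.
have I0 y : `]x / 2, x + 1[%classic y -> 0 < y.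
  by rewrite /= in_itv/= => /andP[+ _]; exact: lt_trans.
have intk y : `]x / 2, x + 1[%classic y -> integrable0y (lker m y).
  by move=> /I0; exact: integrable_lker.
have dk y t : `]x / 2, x + 1[%classic y -> pos t ->
    derivable ((lker m)^~ t) y 1.
  by move=> _ _; have [] := is_derive_lker_param m y t.
have d1k y t : partial1of2 (lker m) y t = - lker m.+1 y t.
  by rewrite partial1of2E; have [_ ->] := is_derive_lker_param m y t.
have kG y t : `]x / 2, x + 1[%classic y -> pos t ->
    `|partial1of2 (lker m) y t| <= G t.
  move=> yI; rewrite in_posE d1k normrN => t0.
  rewrite gtr0_norm ?lker_gt0//; apply: le_trans (ler_norm _).
  apply: le_trans (lker_le _ (I0 _ yI) t0) _.
  rewrite ler_wpM2r ?(ltW (wgt_gt0 t0))// ler_wpM2l//.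
  rewrite lef_pV2 ?posrE ?exprn_gt0 ?(I0 y yI)//.
  rewrite lerXn2r ?nnegrE ?ltW ?(I0 y yI)//.
  by move: yI; rewrite /= in_itv/= => /andP[].
have G0 t : 0 <= G t by exact: normr_ge0.
split.
  exact: (derivable_under_integral measurable_pos xI intk dk G0 intG kG).
rewrite -derive1E.
have -> := differentiation_under_integral measurable_pos xI intk dk G0 intG kG.
rewrite -[RHS]mulN1r -integral0yZ; last exact: integrable_lker.
by apply: eq_Rintegral => t _; rewrite d1k mulN1r.
Qed.

Lemma cvg_inv_nat2 : (i.+2%:R^-1 : R) @[i --> \oo] --> (0 : R).
Proof. by have := @cvg_harmonic R; rewrite -cvg_shiftS. Qed.

Lemma wgt_le t : 0 < t -> wgt t <= t^-1.
Proof.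
move=> t0; rewrite lef_pV2 ?posrE ?mulr_gt0 ?ell_gt0// ler_peMr ?(ltW t0)//.
by have := ell_ge4 t; lra.
Qed.

Lemma lker_le_expn m x t : 0 < x -> 0 < t -> lker m.+1 x t <= t ^+ m.
Proof.
move=> x0 t0.
have -> : lker m.+1 x t = t ^+ m * (expR (- (x * t)) * (t * wgt t)).
  by rewrite lkerS /lker; ring.
rewrite ler_piMr ?exprn_ge0 ?(ltW t0)// mulr_ile1 ?expR_ge0//.
- by rewrite mulr_ge0 ?(ltW t0)// ltW// wgt_gt0.
- by rewrite expR_le1 oppr_le0 mulr_ge0 ?ltW.
- by rewrite -ler_pdivlMl// mulr1 wgt_le.
Qed.

Lemma lker_le_inv m x t : 0 < x -> 0 < t ->
  lker m.+1 x t <= m.+1`!%:R / x ^+ m.+1 * t^-1.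
Proof.
move=> x0 t0; apply: le_trans (lker_le m.+1 x0 t0) _.
by rewrite ler_wpM2l ?wgt_le// divr_ge0// exprn_ge0 ?ltW.
Qed.

(** Obtained by integrating the derivative of [lker m.+2 x], which vanishes at
    both ends of ]0, +oo[. *)
Lemma moment_recurrence m x : 0 < x ->
  x * moment m.+2 x = m.+1%:R * moment m.+1 x - 2 * lmoment m.+1 x.
Proof.
move=> x0.
pose f t := (m.+1%:R * lker m.+1 x t + (- 2) * (lam t * lker m.+1 x t))
            + (- x) * lker m.+2 x t.
have intf : integrable0y f.
  apply: integrable0yD; [apply: integrable0yD|]; apply: integrable0yZ.
  - exact: integrable_lker.
  - exact: integrable_lam_lker.
  - exact: integrable_lker.
have : integral0y f = 0 - 0.
  apply: (@integral0y_derive _ (lker m.+2 x)) => //.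
  - move=> t t0; have := is_derive_lker m.+2 x t0.
    congr is_derive; rewrite /f (lkerS m.+1) -natr1 -natr1; field.
    by rewrite gt_eqF.
  - move=> t t0; apply: continuousD; [apply: continuousD|]; apply: continuousM;
      try exact: cvg_cst; try exact: continuous_lker.
    by apply: continuousM; [exact: continuous_lam|exact: continuous_lker].
  - apply: (squeeze_cvgr _ (cvg_cst 0) cvg_inv_nat2).
    apply: nearW => i; have i0 : 0 < i.+2%:R^-1 :> R by rewrite invr_gt0.
    rewrite (ltW (lker_gt0 _ _ i0))/=.
    apply: le_trans (lker_le_expn _ x0 i0) _.
    rewrite exprS ler_piMr ?(ltW i0)// exprn_ile1 ?(ltW i0)//.
    by rewrite invf_le1// ler1n.
  - pose C : R := m.+2`!%:R / x ^+ m.+2.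
    have cC : C * i.+2%:R^-1 @[i --> \oo] --> (0 : R).
      by rewrite -(mulr0 C); apply: cvgM; [exact: cvg_cst|exact: cvg_inv_nat2].
    apply: (squeeze_cvgr _ (cvg_cst 0) cC).
    apply: nearW => i; have i0 : 0 < i.+2%:R :> R by [].
    by rewrite (ltW (lker_gt0 _ _ i0))/= lker_le_inv.
rewrite subr0 integral0yD; last 2 first.
- apply: integrable0yD; apply: integrable0yZ; first exact: integrable_lker.
  exact: integrable_lam_lker.
- by apply: integrable0yZ; exact: integrable_lker.
rewrite integral0yD ?integral0yZ; try exact: integrable_lker;
  try exact: integrable_lam_lker.
- by rewrite -/(moment _ _) -/(moment _ _) -/(lmoment _ _); lra.
- by apply: integrable0yZ; exact: integrable_lker.
- by apply: integrable0yZ; exact: integrable_lam_lker.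
Qed.

End Moments.

(** * Iterated derivatives of alternating sequences *)

Section IteratedDerivatives.
Context {R : realType}.
Implicit Types (f : R -> R) (g : nat -> R -> R) (x : R).

(** If each g k has derivative - g (k+1) on ]0, +oo[, the iterated derivatives
    of g 0 are the functions g k with alternating signs. *)
Lemma derive1n_alternating g f :
  (forall k x, 0 < x -> is_derive x 1 (g k) (- g k.+1 x)) ->
  (forall x, 0 < x -> f x = g 0 x) ->
  forall k x, 0 < x -> f^`(k)%classic x = (-1) ^+ k * g k x /\
                       derivable f^`(k)%classic x 1.
Proof.
move=> dg fg.
have step k : (forall x, 0 < x -> f^`(k)%classic x = (-1) ^+ k * g k x) ->
    forall x, 0 < x ->
    is_derive x 1 f^`(k)%classic ((-1) ^+ k.+1 * g k.+1 x).
  move=> fk x x0; have d := is_deriveZ ((-1) ^+ k : R) (dg k x x0).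
  rewrite (_ : _ * _ = (-1) ^+ k *: - g k.+1 x); last first.
    by rewrite /GRing.scale/= exprS; ring.
  apply: (near_eq_is_derive _ d) => //.
  near=> y; rewrite fk//.
  by near: y; exact: (lt_nbhsr x0).
suff fk k x : 0 < x -> f^`(k)%classic x = (-1) ^+ k * g k x.
  by move=> k x x0; split; [exact: fk|have [] := step k (fk k) x x0].
elim: k x => [|k ih] x x0; first by rewrite derive1n0 fg// expr0 mul1r.
by rewrite derive1nS derive1E; have [_ ->] := step k ih x x0.
Unshelve. all: end_near. Qed.

End IteratedDerivatives.

(** * The Leibniz expansion of a product of two moments *)

Section Leibniz.
Context {R : realType}.
Implicit Types (A B M N : nat -> R) (a b k i : nat).

(** The sum of the products binomial(k, j) A (a + j) B (b + k - j) for j <= k.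
    When A and B are moment sequences, it is the double integral of
    (u + v)^k u^a v^b; the recursion splits off one factor u + v. *)
Fixpoint leibniz A B k a b : R :=
  if k is k'.+1 then leibniz A B k' a.+1 b + leibniz A B k' a b.+1
  else A a * B b.

Lemma leibniz_sym A k a b : leibniz A A k a b = leibniz A A k b a.
Proof.
elim: k a b => [|k ih] a b /=; first exact: mulrC.
by rewrite ih [X in _ + X]ih addrC.
Qed.

Lemma leibniz_ge0 A B k a b :
  (forall i, 0 <= A i) -> (forall i, 0 <= B i) -> 0 <= leibniz A B k a b.
Proof.
move=> A0 B0; elim: k a b => [|k ih] a b /=; first exact: mulr_ge0.
exact: addr_ge0.
Qed.

Lemma leibniz_shift A B i k a b :
  leibniz (fun j => A (j + i)%N) (fun j => B (j + i)%N) k a b =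
  leibniz A B k (a + i) (b + i).
Proof. by elim: k a b => [|k ih] a b //=; rewrite !ih !addSn. Qed.

Lemma is_derive_leibniz (A B : nat -> R -> R) (x : R) k a b :
  (forall i, is_derive x 1 (A i) (- A i.+1 x)) ->
  (forall i, is_derive x 1 (B i) (- B i.+1 x)) ->
  is_derive x 1 (fun y => leibniz (A^~ y) (B^~ y) k a b)
    (- leibniz (A^~ x) (B^~ x) k.+1 a b).
Proof.
move=> dA dB; elim: k a b => [|k ih] a b.
  apply: (is_derive_eq (is_deriveM (dA a) (dB b))).
  by rewrite /GRing.scale/=; ring.
apply: (is_derive_eq (is_deriveD (ih a.+1 b) (ih a b.+1))).
by rewrite /= !opprD.
Qed.

(** Integration by parts along the lines u + v = s, where (u + v)^k is constant.
    Here M i and N i stand for the integrals of t^i q(t) e^(-x t) and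
    t^i q'(t) e^(-x t), and the hypothesis is integration by parts in one
    variable.  The predecessors of 0 only occur with coefficient 0. *)
Lemma leibniz_by_parts M N (x : R) k a b :
  (forall i, N i = x * M i - i%:R * M i.-1) ->
  leibniz N M k a b - leibniz M N k a b =
  b%:R * leibniz M M k a b.-1 - a%:R * leibniz M M k a.-1 b.
Proof.
move=> NE; elim: k a b => [|k ih] a b /=; first by rewrite !NE; ring.
have -> (p q r s : R) : p + q - (r + s) = p - r + (q - s) by ring.
rewrite !ih/= -!natr1.
by case: a => [|a]; case: b => [|b] /=; ring.
Qed.

End Leibniz.

(** * Iterated integrals of separable kernels *)

Section IteratedIntegrals.
Context {R : realType}.
Implicit Types (K L : R -> R -> R) (c d : R) (f g : R -> R).

(** The kernel K is integrable in v and then in u, with iterated integral c. *)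
Definition iterated K c : Prop :=
  [/\ forall u : R, 0 < u -> integrable0y (K u),
      integrable0y (fun u => integral0y (K u)) &
      integral0y (fun u => integral0y (K u)) = c].

Lemma eq_iterated K L c :
  (forall u v : R, 0 < u -> 0 < v -> K u v = L u v) ->
  iterated K c -> iterated L c.
Proof.
move=> KL [intK intIK <-].
have KLu u : 0 < u -> integral0y (K u) = integral0y (L u).
  by move=> u0; apply: eq_integral0y => v; exact: KL.
split.
- by move=> u u0; apply: eq_integrable0y (intK u u0) => v; exact: KL.
- exact: eq_integrable0y intIK.
- by apply: eq_integral0y => u /KLu.
Qed.

Lemma iterated_prod f g : integrable0y f -> integrable0y g ->
  iterated (fun u v => f u * g v) (integral0y f * integral0y g).
Proof.
move=> intf intg.
have E u : integral0y (fun v => f u * g v) = integral0y g * f u.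
  by rewrite integral0yZ// mulrC.
split.
- by move=> u _; exact: integrable0yZ.
- under eq_fun do rewrite E; exact: integrable0yZ.
- by under eq_fun do rewrite E; rewrite integral0yZ// mulrC.
Qed.

Lemma iteratedD K L c d : iterated K c -> iterated L d ->
  iterated (fun u v => K u v + L u v) (c + d).
Proof.
move=> [intK intIK <-] [intL intIL <-].
have E u : 0 < u ->
    integral0y (K u) + integral0y (L u) = integral0y (fun v => K u v + L u v).
  by move=> u0; rewrite integral0yD//; [exact: intK|exact: intL].
split.
- by move=> u u0; apply: integrable0yD; [exact: intK|exact: intL].
- exact: (eq_integrable0y E (integrable0yD intIK intIL)).
- by rewrite -(eq_integral0y E) integral0yD.
Qed.

Lemma iteratedZ (a : R) K c : iterated K c ->
  iterated (fun u v => a * K u v) (a * c).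
Proof.
move=> [intK intIK <-].
have E u : 0 < u -> a * integral0y (K u) = integral0y (fun v => a * K u v).
  by move=> u0; rewrite integral0yZ//; exact: intK.
split.
- by move=> u u0; apply: integrable0yZ; exact: intK.
- exact: (eq_integrable0y E (integrable0yZ a intIK)).
- by rewrite -(eq_integral0y E) integral0yZ.
Qed.

Lemma iterated_ge0 K c :
  (forall u v : R, 0 < u -> 0 < v -> 0 <= K u v) -> iterated K c -> 0 <= c.
Proof.
move=> K0 [_ _ <-]; apply: integral0y_ge0 => u u0.
by apply: integral0y_ge0 => v v0; exact: K0.
Qed.

Lemma iterated_leibniz f g k a b :
  (forall i, integrable0y (fun t => t ^+ i * f t)) ->
  (forall i, integrable0y (fun t => t ^+ i * g t)) ->
  iterated (fun u v => (u + v) ^+ k * ((u ^+ a * f u) * (v ^+ b * g v)))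
    (leibniz (fun i => integral0y (fun t => t ^+ i * f t))
             (fun i => integral0y (fun t => t ^+ i * g t)) k a b).
Proof.
move=> intf intg; elim: k a b => [|k ih] a b.
  apply: eq_iterated (iterated_prod (intf a) (intg b)) => u v _ _.
  by rewrite expr0 mul1r.
apply: eq_iterated (iteratedD (ih a.+1 b) (ih a b.+1)) => u v _ _.
by rewrite !exprS; ring.
Qed.

End IteratedIntegrals.

(** * Log-concavity and the inequality between Leibniz expansions *)

Section Positivity.
Context {R : realType}.
Implicit Types (t u v x : R) (m n k a b : nat).

(** With q(t) = t / (pi^2 + ln^2 t), one has psi(t) / t = q'(t) / q(t). *)
Definition psi t : R := 1 - 2 * lam t.

Lemma is_derive_psi_div t : 0 < t -> is_derive t 1 (fun u : R => psi u / u)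
  (- (ell t * (ell t - 2 * ln t - 2) + 4 * pi ^+ 2) / (t * ell t) ^+ 2).
Proof.
move=> t0; have dl := is_derive_lam t0.
have dpsi : is_derive t 1 psi (0 - 2 *: ((1 - 2 * ln t * lam t) / (t * ell t))).
  exact: (is_deriveB (is_derive_cst (1 : R) t 1) (is_deriveZ (2 : R) dl)).
have dV : is_derive t 1 (fun u : R => u^-1) (- t ^- 2 *: 1).
  by apply: is_deriveV; rewrite gt_eqF.
apply: (is_derive_eq (is_deriveM dpsi dV)).
have -> : 4 * pi ^+ 2 = 4 * (ell t - ln t ^+ 2) :> R by rewrite /ell addrK.
rewrite /psi /lam /GRing.scale/=; field.
by rewrite ell_neq0 gt_eqF.
Qed.

(** The function q(t) = t / (pi^2 + ln^2 t) is log-concave. *)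
Lemma psi_div_nincr u v : 0 < u -> u <= v -> psi v / v <= psi u / u.
Proof.
move=> u0 uv.
have pos_itv w : w \in `]0, v + 1[ -> 0 < w by rewrite in_itv/= => /andP[].
apply: (@ler0_derive1_le_oo R (fun w => psi w / w) 0 (v + 1)).
- by move=> w /pos_itv/is_derive_psi_div[].
- move=> w /pos_itv w0; rewrite derive1E; have [_ ->] := is_derive_psi_div w0.
  rewrite mulNr oppr_le0 divr_ge0 ?sqr_ge0//.
  rewrite addr_ge0 ?mulr_ge0 ?pi_ge0 ?(ltW (ell_gt0 w))//.
  (* ell w - 2 ln w - 2 = (pi^2 - 3) + (ln w - 1)^2 *)
  by have := pi_ge2 R; rewrite /ell; have := sqr_ge0 (ln w - 1); nra.
- move=> w; rewrite inE/= => /pos_itv w0.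
  exact: is_derive_continuous (is_derive_psi_div w0).
- by rewrite in_itv/= (lt_le_trans u0 uv)/= ltrDl.
- by rewrite in_itv/= u0/= (le_lt_trans uv)// ltrDl.
- exact: uv.
Qed.

Lemma psi_cross_ge0 u v : 0 < u -> 0 < v ->
  0 <= (v - u) * (psi u * v - u * psi v).
Proof.
move=> u0 v0.
have -> : (v - u) * (psi u * v - u * psi v) =
   (u * v) * ((v - u) * (psi u / u - psi v / v)).
  by field; rewrite !gt_eqF.
apply: mulr_ge0; first by rewrite mulr_ge0 ?ltW.
have [uv|/ltW vu] := leP u v.
  by rewrite mulr_ge0 ?subr_ge0 ?psi_div_nincr.
by rewrite mulr_le0 ?subr_le0 ?psi_div_nincr.
Qed.

Lemma lkerD i m x t : lker (i + m) x t = t ^+ i * lker m x t.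
Proof. by rewrite /lker exprD !mulrA. Qed.

Lemma integrable_psi_lker m x : 0 < x ->
  integrable0y (fun t => psi t * lker m x t).
Proof.
move=> x0.
apply: (@eq_integrable0y _
  (fun t => lker m x t + (- 2) * (lam t * lker m x t))).
  by move=> t _; rewrite /psi; ring.
apply: integrable0yD; first exact: integrable_lker.
by apply: integrable0yZ; exact: integrable_lam_lker.
Qed.

Lemma integral0y_psi_lker m x : 0 < x ->
  integral0y (fun t => psi t * lker m x t) = moment m x - 2 * lmoment m x.
Proof.
move=> x0.
rewrite (@eq_integral0y _ _
  (fun t => lker m x t + (- 2) * (lam t * lker m x t))); last first.
  by move=> t _; rewrite /psi; ring.
rewrite integral0yD; last 2 first.
- exact: integrable_lker.
- by apply: integrable0yZ; exact: integrable_lam_lker.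
by rewrite integral0yZ ?mulNr//; exact: integrable_lam_lker.
Qed.

(** The sign of the k-th derivative of H at the critical alpha = m / (m + 1),
    for n = m + 2.  For m = 0 the left-hand side is 0. *)
Lemma leibniz_moment_ge x k m : 0 < x ->
  m%:R * leibniz (moment^~ x) (moment^~ x) k m.+1 m.+3 <=
  m.+1%:R * leibniz (moment^~ x) (moment^~ x) k m.+2 m.+2.
Proof.
move=> x0.
(* f t = q(t) e^(-x t) and g t = q'(t) e^(-x t) *)
pose f t := lker 2 x t; pose g t := psi t * lker 1 x t.
have fE i t : t ^+ i * f t = lker (i + 2) x t by rewrite lkerD.
have gE i t : t ^+ i * g t = psi t * lker (i + 1) x t.
  by rewrite lkerD /g mulrCA.
have intf i : integrable0y (fun t => t ^+ i * f t).
  by under eq_fun do rewrite fE; exact: integrable_lker.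
have intg i : integrable0y (fun t => t ^+ i * g t).
  by under eq_fun do rewrite gE; exact: integrable_psi_lker.
pose M i := integral0y (fun t => t ^+ i * f t).
pose N i := integral0y (fun t => t ^+ i * g t).
have ME i : M i = moment (i + 2) x by rewrite /M; under eq_fun do rewrite fE.
have NE i : N i = x * M i - i%:R * M i.-1.
  rewrite /N; under eq_fun do rewrite gE.
  rewrite integral0y_psi_lker// !ME addn2 addn1 moment_recurrence//.
  by case: i => [|i] /=; rewrite ?addn2 -?natr1; ring.
have MM : leibniz M M k =
    fun a b => leibniz (moment^~ x) (moment^~ x) k (a + 2) (b + 2).
  apply/funext => a; apply/funext => b; rewrite -leibniz_shift.
  by congr leibniz; apply/funext => i; rewrite ME.
have D a b := leibniz_by_parts k a b NE.
have it1 a b := iterated_leibniz k a b intg intf.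
have it2 a b := iterated_leibniz k a b intf intg.
pose K u v := (u + v) ^+ k * (u * v) ^+ m * (lker 1 x u * lker 1 x v)
     * ((v - u) * (psi u * v - u * psi v)).
have D1 := D m m.+1; have D2 := D m.+1 m; rewrite !MM/= in D1 D2.
have : 0 <= (leibniz N M k m m.+1 - leibniz M N k m m.+1)
              - (leibniz N M k m.+1 m - leibniz M N k m.+1 m).
  rewrite (_ : _ - _ = leibniz N M k m m.+1 + -1 * leibniz M N k m m.+1 +
    (-1 * leibniz N M k m.+1 m + leibniz M N k m.+1 m)); last by ring.
  apply: (@iterated_ge0 _ K).
    move=> u v u0 v0.
    rewrite /K mulr_ge0 ?psi_cross_ge0// mulr_ge0//; last first.
      by rewrite mulr_ge0// ltW// lker_gt0.
    by rewrite mulr_ge0// exprn_ge0// ?addr_ge0 ?mulr_ge0 ?ltW.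
  apply: eq_iterated
    (iteratedD (iteratedD (it1 m m.+1) (iteratedZ (-1) (it2 m m.+1)))
      (iteratedD (iteratedZ (-1) (it1 m.+1 m)) (it2 m.+1 m))) => u v _ _.
  by rewrite /K /f /g !(lkerS 1) exprMn !exprS; ring.
(* The case m = 0 is separate because m.-1 is then truncated. *)
rewrite D1 D2; case: m {K D D1 D2} => [|m] /=.
  by move=> _; rewrite mul0r mul1r leibniz_ge0// => i; exact/ltW/moment_gt0.
rewrite !addn2 (leibniz_sym _ _ m.+4 m.+2); lra.
Qed.

End Positivity.

(** * The function H and the two bounds on alpha *)

Section TuranType.
Context {R : realType}.
Implicit Types (t x eps alpha : R) (m n k : nat).

Lemma I_R_E x : I_R x = moment 0 x.
Proof. by apply: eq_Rintegral => t _; rewrite /lker expr0 mul1r. Qed.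

Lemma derive1n_I_R n x : 0 < x ->
  (@I_R R)^`(n)%classic x = (-1) ^+ n * moment n x.
Proof.
move=> x0; apply: (derive1n_alternating _ _ n x0).1 => //.
  by move=> k y; exact: is_derive_moment.
by move=> y _; exact: I_R_E.
Qed.

Lemma H_E n alpha x : 0 < x ->
  H n.+1 alpha x = moment n.+1 x ^+ 2 - alpha * moment n x * moment n.+2 x.
Proof.
move=> x0; rewrite /H succnK !derive1n_I_R// !exprS.
have s : (-1) ^+ n * (-1) ^+ n = 1 :> R by rewrite -exprMn mulrNN mulr1 expr1n.
rewrite (_ : _ - _ = (-1) ^+ n * (-1) ^+ n *
  (moment n.+1 x * moment n.+1 x - alpha * moment n x * moment n.+2 x));
  last by ring.
by rewrite s; ring.
Qed.

(** Up to the sign (-1)^k, the k-th derivative of [H n.+1 alpha]. *)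
Definition Hder n alpha k x : R := leibniz (moment^~ x) (moment^~ x) k n.+1 n.+1
  - alpha * leibniz (moment^~ x) (moment^~ x) k n n.+2.

Lemma derive1n_H n alpha k x : 0 < x ->
  (H n.+1 alpha)^`(k)%classic x = (-1) ^+ k * Hder n alpha k x /\
  derivable (H n.+1 alpha)^`(k)%classic x 1.
Proof.
move=> x0.
have HE (y : R) : 0 < y -> H n.+1 alpha y = Hder n alpha 0 y.
  by move=> y0; rewrite H_E// /Hder/= expr2 mulrA.
suff dHk j (y : R) : 0 < y ->
    is_derive y 1 (Hder n alpha j) (- Hder n alpha j.+1 y).
  exact: (@derive1n_alternating R (Hder n alpha) _ dHk HE k x x0).
move=> y0; have dF i := is_derive_moment i y0.
have d a b := is_derive_leibniz j a b dF dF.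
have dB := is_deriveB (d n.+1 n.+1) (is_deriveZ alpha (d n n.+2)).
apply: (is_derive_eq dB).
by rewrite /Hder /GRing.scale/=; ring.
Qed.

Lemma completely_monotonic_H n alpha : alpha * n.+1%:R <= n%:R ->
  completely_monotonic (fun x : R => H n.+2 alpha x).
Proof.
move=> an k x x0; have [-> dH] := derive1n_H n.+1 alpha k x0; split=> //.
rewrite mulrA -exprMn mulrNN mulr1 expr1n mul1r /Hder.
have := leibniz_moment_ge k n x0.
have : 0 <= leibniz (moment^~ x) (moment^~ x) k n.+1 n.+3.
  by apply: leibniz_ge0 => i; exact/ltW/moment_gt0.
move: (leibniz _ _ _ _ _) (leibniz _ _ _ _ _) => A B A0 AB.
have n0 : 0 < n.+1%:R :> R by [].
rewrite -(pmulr_rge0 _ n0); nra.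
Qed.

(** The logarithmic factor is smaller than eps for t < e^(-1/eps), and at most 1
    elsewhere. *)
Lemma lam_le eps t : 0 < eps -> 0 < t ->
  `|lam t| <= eps + expR (eps^-1) * t.
Proof.
move=> e0 t0; have [tl|tl] := leP (expR (- eps^-1)) t.
  apply: (le_trans (normr_lam_le1 t)).
  rewrite -[leLHS]add0r lerD ?(ltW e0)//.
  by rewrite mulrC -ler_pdivrMr ?expR_gt0// div1r -expRN.
rewrite -[leLHS]addr0 lerD//; last by rewrite mulr_ge0 ?expR_ge0 ?ltW.
have lt_ : ln t < - eps^-1 by rewrite -[ltRHS]expRK ltr_ln ?posrE ?expR_gt0.
have e1 : 0 < eps^-1 by rewrite invr_gt0.
rewrite /lam normf_div (gtr0_norm (ell_gt0 t)) ler_pdivrMr ?ell_gt0//.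
rewrite ltr0_norm; last by lra.
rewrite -ler_pdivrMl// /ell; have := sqr_ge0 (@pi R); nra.
Qed.

Lemma lmoment_le eps m x : 0 < eps -> 0 < x ->
  `|lmoment m x| <= eps * moment m x + expR (eps^-1) * moment m.+1 x.
Proof.
move=> e0 x0.
have intk := integrable_lker m x0; have intk1 := integrable_lker m.+1 x0.
have intl := integrable_lam_lker m x0.
have intg :
    integrable0y (fun t => eps * lker m x t + expR eps^-1 * lker m.+1 x t).
  by apply: integrable0yD; exact: integrable0yZ.
have boundE :
    integral0y (fun t => eps * lker m x t + expR eps^-1 * lker m.+1 x t) =
    eps * moment m x + expR (eps^-1) * moment m.+1 x.
  by rewrite integral0yD ?integral0yZ//; exact: integrable0yZ.
have bnd t : 0 < t ->
    `|lam t * lker m x t| <= eps * lker m x t + expR eps^-1 * lker m.+1 x t.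
  move=> t0; rewrite lkerS mulrA -mulrDl normrM (gtr0_norm (lker_gt0 m x t0)).
  by rewrite ler_wpM2r ?lam_le// ltW// lker_gt0.
rewrite ler_norml -boundE; apply/andP; split.
  rewrite -mulN1r -integral0yZ//; apply: le_integral0y => //.
    exact: integrable0yZ.
  by move=> t /bnd; rewrite ler_norml mulN1r => /andP[].
by apply: le_integral0y => // t /bnd; rewrite ler_norml => /andP[].
Qed.

(** The moments with the factor [lam] are negligible at +oo: by the recurrence,
    moment (m+2) is at most (m+3)/x times moment (m+1). *)
Lemma lmoment_small eps m : 0 < eps ->
  \forall x \near +oo, `|lmoment m.+1 x| <= eps * moment m.+1 x.
Proof.
move=> e0; pose C := expR ((eps / 2)^-1).
have C0 : 0 < C by exact: expR_gt0.
near=> x.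
have x0 : 0 < x by near: x; exact: nbhs_pinfty_gt.
have e20 : 0 < eps / 2 by lra.
have F0 := moment_gt0 m.+1 x0.
have := lmoment_le m.+1 e20 x0; rewrite -/C => /le_trans; apply.
have xC : C * m.+3%:R / (eps / 2) <= x.
  by near: x; apply: nbhs_pinfty_ge; exact: num_real.
have E1 : `|lmoment m.+1 x| <= moment m.+1 x.
  rewrite ler_norml; apply/andP; split.
    rewrite /moment -mulN1r -integral0yZ; last exact: integrable_lker.
    apply: le_integral0y.
    - by apply: integrable0yZ; exact: integrable_lker.
    - exact: integrable_lam_lker.
    - move=> t t0; rewrite ler_wpM2r ?(ltW (lker_gt0 _ _ t0))//.
      by have := normr_lam_le1 t; rewrite ler_norml => /andP[].
  apply: le_integral0y; [exact: integrable_lam_lker|exact: integrable_lker|].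
  move=> t t0; rewrite ler_piMl ?(ltW (lker_gt0 _ _ t0))//.
  by have := normr_lam_le1 t; rewrite ler_norml => /andP[].
have F1 : x * moment m.+2 x <= m.+3%:R * moment m.+1 x.
  rewrite moment_recurrence// -[m.+3]addn2 natrD mulrDl.
  by move: E1; rewrite ler_norml => /andP[+ _]; lra.
rewrite -(ler_pM2l x0).
have h : C * m.+3%:R <= x * (eps / 2) by rewrite -ler_pdivrMr.
have := ler_wpM2l (ltW C0) F1; have := ler_wpM2r (ltW F0) h; lra.
Unshelve. all: end_near. Qed.

(** Nonnegativity of H alone, without its derivatives, bounds alpha. *)
Lemma alpha_le_of_H_ge0 n alpha : (forall x, 0 < x -> 0 <= H n.+2 alpha x) ->
  alpha * n.+2%:R <= n.+1%:R.
Proof.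
move=> H0; rewrite leNgt; apply/negP => an.
have a0 : 0 < alpha.
  have : 0 < alpha * n.+2%:R by apply: le_lt_trans an.
  by rewrite pmulr_lgt0.
pose d := alpha * n.+2%:R - n.+1%:R; have d0 : 0 < d by rewrite subr_gt0.
(* Chosen so that 2 eps (1 + alpha) = d / 2 < d. *)
pose eps := d / (4 * (1 + alpha)).
have e0 : 0 < eps by rewrite divr_gt0// mulr_gt0// addr_gt0.
have epsE : eps * (4 * (1 + alpha)) = d.
  by rewrite /eps divfK// gt_eqF// mulr_gt0// addr_gt0.
suff : exists x, [/\ 0 < x, `|lmoment n.+1 x| <= eps * moment n.+1 x &
                           `|lmoment n.+2 x| <= eps * moment n.+2 x].
  move=> [x [x0 E1 E2]].
  have := H0 x x0; rewrite H_E// => Hx.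
  have r1 := moment_recurrence n x0; have r2 := moment_recurrence n.+1 x0.
  have F1 := moment_gt0 n.+1 x0; have F2 := moment_gt0 n.+2 x0.
  have F3 := moment_gt0 n.+3 x0.
  have u1 : x * moment n.+2 x <= (n.+1%:R + 2 * eps) * moment n.+1 x.
    by move: E1; rewrite ler_norml => /andP[]; lra.
  have u2 : (n.+2%:R - 2 * eps) * moment n.+2 x <= x * moment n.+3 x.
    by move: E2; rewrite ler_norml => /andP[]; lra.
  have : alpha * (n.+2%:R - 2 * eps) * moment n.+2 x ^+ 2 <=
      (n.+1%:R + 2 * eps) * moment n.+2 x ^+ 2.
    have A1 : alpha * moment n.+2 x * ((n.+2%:R - 2 * eps) * moment n.+2 x) <=
        alpha * moment n.+2 x * (x * moment n.+3 x).
      by rewrite ler_wpM2l// mulr_ge0// ltW.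
    have A2 : alpha * moment n.+3 x * (x * moment n.+2 x) <=
        alpha * moment n.+3 x * ((n.+1%:R + 2 * eps) * moment n.+1 x).
      by rewrite ler_wpM2l// mulr_ge0// ltW.
    have A3 : 0 <= (n.+1%:R + 2 * eps) *
       (moment n.+2 x ^+ 2 - alpha * moment n.+1 x * moment n.+3 x).
      by rewrite mulr_ge0// addr_ge0// mulr_ge0// ltW.
    lra.
  rewrite ler_pM2r ?exprn_gt0//; move: epsE; rewrite /d; lra.
have : \forall x \near +oo, [/\ 0 < x,
    `|lmoment n.+1 x| <= eps * moment n.+1 x &
    `|lmoment n.+2 x| <= eps * moment n.+2 x].
  by near=> x; split; near: x;
    [exact: nbhs_pinfty_gt|exact: lmoment_small|exact: lmoment_small].
by move=> /filter_ex[x]; exists x.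
Unshelve. all: end_near. Qed.

End TuranType.

Theorem theorem9 (R : realType) (n : nat) (hn : (2 <= n)%N) :
  (forall alpha : R, completely_monotonic (fun x : R => H n alpha x) ->
     alpha <= (n%:R - 1) / n%:R) /\
  (forall alpha : R, alpha <= (n%:R - 2) / (n%:R - 1) ->
     completely_monotonic (fun x : R => H n alpha x)).
Proof.
case: n hn => [|[|n]]// _.
have n1 : n.+2%:R - 1 = n.+1%:R :> R by rewrite -natr1 addrK.
have n2 : n.+2%:R - 2 = n%:R :> R by rewrite -[n.+2]addn2 natrD addrK.
rewrite n1 n2; split=> alpha.
  move=> cm; rewrite ler_pdivlMr//; apply: alpha_le_of_H_ge0 => x x0.
  by have [_] := cm 0%N x x0; rewrite expr0 mul1r derive1n0.
by rewrite ler_pdivlMr//; exact: completely_monotonic_H.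
Qed.
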